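(* Consider the scheme LAG-II with $\mathbf M=0$ and $\mathbf\Omega=\mathbf\Gamma=\mathbf I_M$: $$\mathbf x^{k+1}=\arg\min_{\mathbf x}f(\mathbf x)+\tfrac12\big\|\mathbf A\mathbf x-\mathbf a^k+\mathbf p^k\big\|^2,\quad\mathbf p^{k+1}=\mathbf p^k+\mathbf A\mathbf x^{k+1}-\mathbf a^k,\quad\mathbf a^{k+1}=\mathrm{prox}_g\big(\mathbf a^k+2\mathbf p^{k+1}-\mathbf p^k\big).$$ Then it can be expressed as $$\mathbf v^{k+1}=\Big(\mathcal I+\big(\tilde{\mathcal D}^\top(\mathcal L+\mathcal K^\top\circ\partial f^*\circ\mathcal K)^{-1}\tilde{\mathcal D}\big)^{-1}\Big)^{-1}\mathbf v^k,$$ where $$\tilde{\mathcal D}=\begin{bmatrix}\mathbf I_M&-\mathbf I_M\end{bmatrix}^\top,\quad\mathcal L=\begin{bmatrix}\partial g&-\mathbf I_M\\\mathbf I_M&0\end{bmatrix},\quad\mathcal K=\begin{bmatrix}0&-\mathbf A^\top\end{bmatrix},$$ and $\mathbf v$ is linked to $(\mathbf a,\mathbf p)$ in LAG-II via $\mathbf v^k=\mathbf a^k-\mathbf p^k\in\mathbb R^M$.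
   Context: $f:\mathbb R^N\to\mathbb R\cup\{+\infty\}$ and $g:\mathbb R^M\to\mathbb R\cup\{+\infty\}$ are proper, lower semicontinuous and convex; $\mathbf A:\mathbb R^N\to\mathbb R^M$ is linear; $f^*$ is the Fenchel conjugate of $f$; $\mathrm{prox}_g(\mathbf u)=\arg\min_{\mathbf w}g(\mathbf w)+\frac12\|\mathbf w-\mathbf u\|^2$. The iterates ($\arg\min$'s) are assumed to exist. $\mathcal L$ is the set-valued operator $\mathcal L(\mathbf a,\mathbf p)=(\partial g(\mathbf a)-\mathbf p)\times\{\mathbf a\}$ on $\mathbb R^M\times\mathbb R^M$; $\mathcal K:\mathbb R^M\times\mathbb R^M\to\mathbb R^N$, $\mathcal K(\mathbf a,\mathbf p)=-\mathbf A^\top\mathbf p$, so $\mathcal K^\top\mathbf x=(0,-\mathbf A\mathbf x)$; $\tilde{\mathcal D}\mathbf v=(\mathbf v,-\mathbf v)$; all operator inverses are set-valued inverses; $\mathcal I$ is the identity. *)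

(* Defs.v *)
From HB Require Import structures.
From mathcomp Require Import all_boot all_order all_algebra.
From mathcomp Require Import all_classical all_reals all_analysis.
Import Order.TTheory GRing.Theory Num.Theory numFieldNormedType.Exports.

Set Implicit Arguments.
Unset Strict Implicit.
Unset Printing Implicit Defensive.

Local Open Scope classical_set_scope.
Local Open Scope ring_scope.

(* The norm `|_| that MathComp-Analysis puts on matrices is the sup norm, so
   the Euclidean norm is introduced through the dot product. *)
Definition dot (R : realType) n (u v : 'cV[R]_n) : R :=
  \sum_(i < n) u i 0 * v i 0.

Definition sqnorm (R : realType) n (u : 'cV[R]_n) : R := dot u u.

Section ConvexAnalysis.
Variables (R : realType) (n : nat).
Implicit Types (f : 'cV[R]_n -> \bar R) (x y u w : 'cV[R]_n).

Definition eproper f : Prop :=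
  (forall x, f x != -oo%E) /\ exists x, f x != +oo%E.

(* The convention 0 * +oo = 0 of \bar R makes t = 0 and t = 1 harmless. *)
Definition econvex f : Prop :=
  forall x y (t : R), 0 <= t -> t <= 1 ->
  (f (t *: x + (1 - t) *: y)%R <= t%:E * f x + (1 - t)%:E * f y)%E.

(* For proper f this set is empty when f x = +oo. *)
Definition subdiff f x : set 'cV[R]_n :=
  [set u | forall y, (f x + (dot u (y - x))%:E <= f y)%E].

Definition conjugate f u : \bar R :=
  ereal_sup [set ((dot x u)%:E - f x)%E | x in [set: 'cV[R]_n]].

Definition argmin f : set 'cV[R]_n := [set x | forall y, (f x <= f y)%E].

(* Set-valued; a singleton when f is proper, lower semicontinuous, convex. *)
Definition prox f u : set 'cV[R]_n :=
  argmin (fun w => (f w + (2^-1 * sqnorm (w - u))%:E)%E).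

End ConvexAnalysis.

Definition setop (U V : Type) := U -> set V.

Section SetValuedOperators.
Variables U V W : Type.

Definition op_inv (T : setop U V) : setop V U := fun v => [set u | T u v].

Definition op_comp (S : setop V W) (T : setop U V) : setop U W :=
  fun u => \bigcup_(v in T u) S v.

Definition op_id : setop U U := fun u => [set u].

End SetValuedOperators.

Definition op_add (U : Type) (V : zmodType) (S T : setop U V) : setop U V :=
  fun u => [set y + z | y in S u & z in T u].

Definition op_mx (R : realType) m n (B : 'M[R]_(m, n)) :
  setop 'cV[R]_n 'cV[R]_m := fun u => [set B *m u].

Section Splitting.
Variables (R : realType) (N M : nat).
Variables (f : 'cV[R]_N -> \bar R) (g : 'cV[R]_M -> \bar R) (A : 'M[R]_(M, N)).

Definition LAG_II (x : nat -> 'cV[R]_N) (a p : nat -> 'cV[R]_M) : Prop :=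
  forall k : nat,
  [/\ argmin (fun y => (f y + (2^-1 * sqnorm (A *m y - a k + p k))%:E)%E)
        (x k.+1),
      p k.+1 = p k + A *m x k.+1 - a k &
      prox g (a k + 2%:R *: p k.+1 - p k) (a k.+1)].

(* R^M x R^M is represented by 'cV_(M + M), the pair (a, p) being
   col_mx a p. *)
Definition Dtilde : 'M[R]_(M + M, M) :=
  (row_mx 1%:M (- 1%:M) : 'M[R]_(M, M + M))^T.

Definition opL : setop 'cV[R]_(M + M) 'cV[R]_(M + M) := fun w =>
  let a := usubmx w in let p := dsubmx w in
  [set col_mx (s - p) a | s in subdiff g a].

Definition opK : 'M[R]_(N, M + M) := row_mx 0 (- A^T).

Definition saddle_op : setop 'cV[R]_(M + M) 'cV[R]_(M + M) :=
  op_add opL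
    (op_comp (op_mx opK^T) (op_comp (subdiff (conjugate f)) (op_mx opK))).

Definition reduced_op : setop 'cV[R]_M 'cV[R]_M :=
  op_inv (op_comp (op_mx Dtilde^T) (op_comp (op_inv saddle_op) (op_mx Dtilde))).

Definition resolvent : setop 'cV[R]_M 'cV[R]_M :=
  op_inv (op_add (@op_id 'cV[R]_M) reduced_op).

End Splitting.

(* Main.v *)
(** The resolvent at [v] consists of the points [a - p] for which there is [x]
    with [x \in ∂f*(-A^T p)], [p = A x - v] and [v + 2 p - a \in ∂g(a)].  The
    optimality conditions of the two minimisations of LAG-II say that the
    iterates solve this system.  Uniqueness needs no Fenchel-Moreau theorem:
    monotonicity of [∂f*] forces [- |p - p'|^2 >= 0] for two solutions, and then
    monotonicity of [∂g] forces [- |a - a'|^2 >= 0]. *)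
Require Import Defs.
From HB Require Import structures.
From mathcomp Require Import all_boot all_order all_algebra.
From mathcomp Require Import all_classical all_reals all_analysis.
From mathcomp Require Import ring lra.
Import Order.TTheory GRing.Theory Num.Theory numFieldNormedType.Exports.
Local Open Scope classical_set_scope.
Local Open Scope ring_scope.

Section DotProduct.
Context {R : realType}.

Lemma dotC {n} (u w : 'cV[R]_n) : dot u w = dot w u.
Proof. by apply: eq_bigr => i _; rewrite mulrC. Qed.

Lemma dotDl {n} (u1 u2 w : 'cV[R]_n) : dot (u1 + u2) w = dot u1 w + dot u2 w.
Proof. by rewrite -big_split; apply: eq_bigr => i _; rewrite mxE mulrDl. Qed.

Lemma dotZl {n} (c : R) (u w : 'cV[R]_n) : dot (c *: u) w = c * dot u w.
Proof. by rewrite /dot big_distrr; apply: eq_bigr => i _; rewrite mxE -mulrA. Qed.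

Lemma dotNl {n} (u w : 'cV[R]_n) : dot (- u) w = - dot u w.
Proof. by rewrite -scaleN1r dotZl mulN1r. Qed.

Lemma dotDr {n} (u w1 w2 : 'cV[R]_n) : dot u (w1 + w2) = dot u w1 + dot u w2.
Proof. by rewrite dotC dotDl !(dotC u). Qed.

Lemma dotZr {n} (c : R) (u w : 'cV[R]_n) : dot u (c *: w) = c * dot u w.
Proof. by rewrite dotC dotZl (dotC u). Qed.

Lemma dotNr {n} (u w : 'cV[R]_n) : dot u (- w) = - dot u w.
Proof. by rewrite dotC dotNl (dotC u). Qed.

Lemma dot_trmul {m n} (B : 'M[R]_(m, n)) (u : 'cV[R]_m) (w : 'cV[R]_n) :
  dot (B^T *m u) w = dot u (B *m w).
Proof.
have dotE k (s t : 'cV[R]_k) : dot s t = (s^T *m t) 0 0.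
  by rewrite mxE; apply: eq_bigr => i _; rewrite mxE.
by rewrite !dotE trmx_mul trmxK mulmxA.
Qed.

Lemma sqnorm_ge0 {n} (u : 'cV[R]_n) : 0 <= sqnorm u.
Proof. by apply: sumr_ge0 => i _; rewrite -expr2 sqr_ge0. Qed.

Lemma sqnorm_eq0 {n} (u : 'cV[R]_n) : sqnorm u = 0 -> u = 0.
Proof.
move/eqP; rewrite psumr_eq0 => [/allP u0|i _]; last by rewrite -expr2 sqr_ge0.
apply/matrixP => i j; rewrite (ord1 j) mxE.
by have /= := u0 i (mem_index_enum i); rewrite mulf_eq0 orbb => /eqP.
Qed.

Lemma sqnormD {n} (u w : 'cV[R]_n) :
  sqnorm (u + w) = sqnorm u + 2 * dot u w + sqnorm w.
Proof. by rewrite /sqnorm dotDl !dotDr (dotC w u); ring. Qed.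

End DotProduct.

Section Subdifferential.
Context {R : realType} {n : nat}.
Implicit Types (h : 'cV[R]_n -> \bar R) (x y u w : 'cV[R]_n).

(** Each subgradient inequality is tested at the other point and the two are added. Together they
    also force [h y] to be finite, so the values cancel. *)
Lemma subdiff_monotone {h x y u w} : h x \is a fin_num ->
  subdiff h x u -> subdiff h y w -> 0 <= dot (u - w) (x - y).
Proof.
move=> hx /(_ y) + /(_ x); rewrite -(fineK hx).
case: (h y) => [s| |]; rewrite -?EFinD ?lee_fin //.
rewrite !(dotDl, dotNl, dotDr, dotNr); lra.
Qed.

(** The subgradient inequality says that the term [dot y u - h y] is largest at [y = x], so the
    supremum is attained there; at any other [w] the term at [x] bounds [conjugate h w] from
    below. *)
Lemma subdiff_conjugate {h x u} : h x \is a fin_num ->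
  subdiff h x u ->
  conjugate h u \is a fin_num /\ subdiff (conjugate h) u x.
Proof.
move=> hx hxu.
have conjE : conjugate h u = (dot x u - fine (h x))%:E.
  apply/eqP; rewrite eq_le; apply/andP; split; last first.
    by apply: ereal_sup_ubound; exists x; rewrite // EFinB fineK.
  apply: ge_ereal_sup => _ [y _ <-]; move: (hxu y); rewrite -(fineK hx).
  case: (h y) => [s| |] /=; rewrite -?EFinD ?lee_fin ?leNye //.
  rewrite dotDr dotNr !(dotC u); lra.
rewrite conjE; split=> // w; rewrite conjE -EFinD.
apply: ereal_sup_ubound; exists x; rewrite // -[h x]fineK // -EFinB.
by congr EFin; rewrite dotDr dotNr; ring.
Qed.

Lemma ge0_of_linear_perturbation (c q : R) : 0 <= q ->
  (forall t, 0 < t -> t <= 1 -> 0 <= c + t * q) -> 0 <= c.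
Proof.
move=> q0 tP; rewrite leNgt; apply/negP => c0.
have d0 : 0 < q - c by lra.
(* This [t] is at most 1/2 and makes [t * q <= - c / 2], so [c + t * q] would be at most
   [c / 2 < 0]. *)
have := tP (- c / (2 * (q - c))).
have e0 : 0 < (q - c)^-1 by rewrite invr_gt0.
have eK : (q - c) * (q - c)^-1 = 1 by rewrite mulfV // gt_eqF.
rewrite invfM; move: ((q - c)^-1) e0 eK => e e0 eK; nra.
Qed.

(** The minimiser [x] is compared with the points of the segment towards [y]: convexity bounds the
    change of [h] linearly in [t], and dividing by [t] and letting it vanish removes the quadratic
    term. The x-update uses [B = A], the prox [B = 1]. *)
Lemma argmin_subdiff {m h} {B : 'M[R]_(m, n)} {b : 'cV[R]_m} {x} :
  eproper h -> econvex h ->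
  argmin (fun y => (h y + (2^-1 * sqnorm (B *m y - b))%:E)%E) x ->
  h x \is a fin_num /\ subdiff h x (- (B^T *m (B *m x - b))).
Proof.
move=> [hNy [z hz]] hconv xmin.
have hx : h x \is a fin_num.
  rewrite fin_numE hNy; apply/eqP => hxy.
  by move: (xmin z) (hNy z) hz; rewrite hxy; case: (h z).
split=> // y.
have [->|hy'] := eqVneq (h y) +oo%E; first by rewrite leey.
have hy : h y \is a fin_num by rewrite fin_numE hNy.
rewrite -(fineK hx) -(fineK hy) -EFinD lee_fin dotNl dot_trmul -subr_ge0.
(* The perturbation is what remains of the second-order term of the penalty after division by
   [t]. *)
apply: (@ge0_of_linear_perturbation _ (2^-1 * sqnorm (B *m (y - x)))).
  by rewrite mulr_ge0 ?sqnorm_ge0.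
move=> t t0 t1.
have := hconv y x t (ltW t0) t1; have := xmin (t *: y + (1 - t) *: x).
have -> : B *m (t *: y + (1 - t) *: x) - b =
    (B *m x - b) + t *: (B *m (y - x)).
  rewrite scalerBl scale1r addrCA -scalerBr mulmxDr -scalemxAr.
  by rewrite addrAC.
rewrite (sqnormD (B *m x - b)) /sqnorm dotZl !dotZr -(fineK hx) -(fineK hy).
case: (h (_ + _)) => [s| |] //=; rewrite -?EFinM -?EFinD ?lee_fin //.
set P := dot (B *m x - b) _; set Q := dot (B *m (y - x)) _; set S := dot _ _.
move=> le1 le2; rewrite -(pmulr_rge0 _ t0); nra.
Qed.

End Subdifferential.

Section Resolvent.
Context {R : realType} {N M : nat}.
Implicit Types (f : 'cV[R]_N -> \bar R) (g : 'cV[R]_M -> \bar R).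

(** Unfolding the inverses gives [r = v - u], [w = col_mx a p] and [s] in [subdiff g a] with
    [r = s - p] and [- r = a - A *m x]; eliminating [r] and [s] leaves the system. *)
Lemma resolventP f g (A : 'M[R]_(M, N)) (v u : 'cV[R]_M) :
  resolvent f g A v u <->
  exists a p x, [/\ u = a - p, p = A *m x - v,
    subdiff (conjugate f) (- (A^T *m p)) x & subdiff g a (v + p *+ 2 - a)].
Proof.
have DtE (w : 'cV[R]_(M + M)) : (Dtilde R M)^T *m w = usubmx w - dsubmx w.
  by rewrite -{1}[w]vsubmxK /Dtilde trmxK mul_row_col mulNmx !mul1mx.
have DE (r : 'cV[R]_M) : Dtilde R M *m r = col_mx r (- r).
  by rewrite /Dtilde tr_row_mx mul_col_mx linearN /= trmx1 mulNmx mul1mx.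
have KE (w : 'cV[R]_(M + M)) : opK A *m w = - (A^T *m dsubmx w).
  by rewrite -{1}[w]vsubmxK /opK mul_row_col mul0mx add0r mulNmx.
have KtE (y : 'cV[R]_N) : (opK A)^T *m y = col_mx 0 (- (A *m y)).
  by rewrite /opK tr_row_mx mul_col_mx linearN /= trmxK trmx0 mul0mx mulNmx.
split.
- case=> _ -> [r [w [_ ->]]].
  case=> _ [s sg <-] [_ [x [_ -> fx] ->]].
  rewrite DE KtE add_col_mx addr0 => /eq_col_mx [rE rE'] uE vE.
  have {}uE : u = usubmx w - dsubmx w by rewrite uE DtE.
  exists (usubmx w), (dsubmx w), x; split; rewrite -?KE //.
    have -> : A *m x = usubmx w + r by rewrite -[r]opprK -rE' opprB addrC subrK.
    rewrite -vE uE -rE; move: (usubmx w) (dsubmx w) => a p.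
    by apply/colP => i; rewrite !mxE; ring.
  suff -> : v + dsubmx w *+ 2 - usubmx w = s by [].
  rewrite -vE uE -rE mulr2n; move: (usubmx w) (dsubmx w) => a p.
  by apply/colP => i; rewrite !mxE; ring.
- case=> a [p [x [-> pE fx ga]]].
  (* The identity contributes [a - p], which forces the element of [reduced_op] to be
     [v - (a - p)]. *)
  exists (a - p) => //; exists (v - (a - p)); last by rewrite addrC subrK.
  exists (col_mx a p); last by rewrite /op_mx /= DtE col_mxKu col_mxKd.
  exists (Dtilde R M *m (v - (a - p))) => //.
  rewrite DE.
  exists (col_mx (v + p *+ 2 - a - p) a).
    by rewrite /opL /= col_mxKu col_mxKd; exists (v + p *+ 2 - a).
  exists (col_mx 0 (- (A *m x))).
    exists x; last by rewrite /op_mx /= KtE.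
    by exists (- (A^T *m p)); rewrite // /op_mx /= KE col_mxKd.
  rewrite add_col_mx addr0 mulr2n; congr col_mx.
    by apply/colP => i; rewrite !mxE; ring.
  have -> : A *m x = p + v by rewrite pE subrK.
  by apply/colP => i; rewrite !mxE; ring.
Qed.

End Resolvent.

Theorem proposition4 (R : realType) (N M : nat)
  (f : 'cV[R]_N -> \bar R) (g : 'cV[R]_M -> \bar R) (A : 'M[R]_(M, N))
  (f_proper : eproper f) (f_lsc : lower_semicontinuous f) (f_convex : econvex f)
  (g_proper : eproper g) (g_lsc : lower_semicontinuous g) (g_convex : econvex g)
  (x : nat -> 'cV[R]_N) (a p v : nat -> 'cV[R]_M)
  (scheme : LAG_II f g A x a p)
  (v_def : forall k : nat, v k = a k - p k) :
  forall k : nat, resolvent f g A (v k) = [set v k.+1].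
Proof.
move=> k; have [xmin pE amin] := scheme k.
move: (a k.+1) (p k.+1) (x k.+1) (v_def k.+1) xmin pE amin.
move=> a' p' x' -> xmin pE amin.
have {}pE : p' = A *m x' - v k by rewrite pE v_def opprB addrCA addrA.
(* The x-update puts [- (A^T *m p')] in [subdiff f x']; passing to the conjugate also yields the
   finite value that monotonicity asks for below. *)
have fx' : subdiff (conjugate f) (- (A^T *m p')) x' /\
    conjugate f (- (A^T *m p')) \is a fin_num.
  have xmin' : argmin (fun y => (f y + (2^-1 * sqnorm (A *m y - v k))%:E)%E) x'.
    move=> y; have := xmin y.
    by rewrite v_def !opprB !(addrC (p k)) !addrA.
  have [fx' dfx'] := argmin_subdiff f_proper f_convex xmin'.
  by rewrite pE; have [] := subdiff_conjugate fx' dfx'.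
have ga' : subdiff g a' (v k + p' *+ 2 - a') /\ g a' \is a fin_num.
  (* The centre of the prox, [a k + 2 p' - p k], equals [v k + 2 p']. *)
  have amin' : argmin (fun w =>
      (g w + (2^-1 * sqnorm (1%:M *m w - (v k + p' *+ 2)))%:E)%E) a'.
    move=> w; have := amin w; rewrite !mul1mx v_def scaler_nat.
    by rewrite [_ - p k]addrAC.
  have [] := argmin_subdiff g_proper g_convex amin'.
  by rewrite trmx1 !mul1mx opprB.
case: fx' ga' => fx' cfin [ga' gfin].
apply/seteqP; split=> [u|_ ->] /=; last by apply/resolventP; exists a', p', x'.
move=> /resolventP[b [q [y [-> qE fy gb]]]].
(* Monotonicity bounds [- dot (p' - q) (A *m (x' - y))] below by 0, and subtracting [qE] from [pE]
   turns the second factor into [p' - q]. *)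
have pq : p' = q.
  apply/eqP; rewrite -subr_eq0; apply/eqP/sqnorm_eq0/eqP.
  rewrite eq_le sqnorm_ge0 andbT.
  have := subdiff_monotone cfin fx' fy.
  have -> : - (A^T *m p') - - (A^T *m q) = - (A^T *m (p' - q)).
    by rewrite mulmxBr opprB opprK addrC.
  rewrite dotNr dotC dot_trmul mulmxBr oppr_ge0.
  by rewrite (_ : A *m x' - A *m y = p' - q) // pE qE opprB addrA subrK.
rewrite -pq in gb *.
(* With [p'] in common, the two subgradients of [g] differ by [b - a'], so pairing with [a' - b]
   gives minus a square. *)
suff -> : a' = b by [].
apply/eqP; rewrite -subr_eq0; apply/eqP/sqnorm_eq0/eqP.
rewrite eq_le sqnorm_ge0 andbT -oppr_ge0 /sqnorm -dotNl.
have := subdiff_monotone gfin ga' gb.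
by rewrite opprB addrC addrA subrK opprB.
Qed.
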